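(* Let $\mathcal{A}$ be an algebra over $\mathbb{C}$, let $q\in\mathbb{C}-\{0\}$ be arbitrary, and let $A_1,A_2,\dots,A_k$ be $2$-by-$2$ matrices with coefficients in $\mathcal{A}$ such that: (1) each $A_i$ is triangular of the form $\begin{pmatrix} a_i & b_i\\ 0& a_i^{-1}\end{pmatrix}$ or $\begin{pmatrix} a_i & 0\\ b_i& a_i^{-1}\end{pmatrix}$, where $a_i,b_i\in\mathcal{A}$, $a_i$ is invertible in $\mathcal{A}$, and $b_ia_i=q\,a_ib_i$; (2) $a_i$ and $b_i$ commute with $a_j$ and $b_j$ whenever $i\neq j$. Then, for every $n$, each of the elements $S_n(\mathrm{Trace}\,A_1A_2\cdots A_k)\in\mathcal{A}$ and $T_n(\mathrm{Trace}\,A_1A_2\cdots A_k)\in\mathcal{A}$ can be written as a sum of positive monomials of the form $+q^{\xi}\prod_{i=1}^k a_i^{\alpha_i}b_i^{\beta_i}$ with integer powers $\xi,\alpha_i,\beta_i\in\mathbb{Z}$, $\beta_i\geq0$.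
   Context: Algebras are associative and unital, not necessarily commutative. The same number $q$ is used for all indices $i$. Products of $2$-by-$2$ matrices over $\mathcal{A}$ are given by the usual formula, and the trace of $\begin{pmatrix} a&b\\c&d\end{pmatrix}$ is $a+d\in\mathcal{A}$. The (normalized) Chebyshev polynomials $T_n(t),S_n(t)\in\mathbb{Z}[t]$, $n\geq 0$, of the first and second kind are defined by $T_0(t)=2$, $T_1(t)=t$, $T_{n+1}(t)=t\,T_n(t)-T_{n-1}(t)$, and $S_0(t)=1$, $S_1(t)=t$, $S_{n+1}(t)=t\,S_n(t)-S_{n-1}(t)$. *)

(* Defs.v *)
From HB Require Import structures.
From mathcomp Require Import all_boot all_order all_algebra.
From mathcomp Require Import reals complex.

Set Implicit Arguments.
Unset Strict Implicit.
Unset Printing Implicit Defensive.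

Import Order.TTheory GRing.Theory Num.Theory.

Local Open Scope ring_scope.

Fixpoint chebT (n : nat) : {poly int} :=
  match n with
  | 0 => 2%:R
  | 1 => 'X
  | (m.+1 as n1).+1 => 'X * chebT n1 - chebT m
  end.

Fixpoint chebS (n : nat) : {poly int} :=
  match n with
  | 0 => 1
  | 1 => 'X
  | (m.+1 as n1).+1 => 'X * chebS n1 - chebS m
  end.

(* The scalars of [map_poly intr p] are integers, hence central, so Horner
   evaluation is unambiguous although [A] need not be commutative. *)
Definition eval_int (A : nzRingType) (p : {poly int}) (x : A) : A :=
  (map_poly (intr : int -> A) p).[x].

Definition mx22 (T : Type) (a b c d : T) : 'M[T]_2 :=
  \matrix_(i < 2, j < 2)
    if i == 0 then if j == 0 then a else b
    else if j == 0 then c else d.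

(* Exponents of the b_i are naturals; exponents of q and the a_i are integers
   ([^] on [unitRingType]), which is the intended power as soon as q and the
   a_i are units. *)
Definition monomial (F : fieldType) (A : unitAlgType F) (k : nat) (q : F)
    (a b : 'I_k -> A) (xi : int) (alpha : 'I_k -> int) (beta : 'I_k -> nat) : A :=
  q ^ xi *: \prod_(i < k) (a i ^ alpha i * b i ^+ beta i).

Definition sum_of_positive_monomials (F : fieldType) (A : unitAlgType F)
    (k : nat) (q : F) (a b : 'I_k -> A) (x : A) : Prop :=
  exists s : seq (int * ('I_k -> int) * ('I_k -> nat)),
    x = \sum_(m <- s) monomial q a b m.1.1 m.1.2 m.2.

(* Main.v *)
(* The matrices A_i are commuting A-points of SL_q(2), so they act on the
   degree d-1 part V_d of the quantum plane yx = qxy, by explicit d x d matrices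
   rho_d(A_i) whose entries are Gaussian binomials in q^2 times monomials in
   a_i, b_i.  The multiplication V_2 (x) V_d -> V_(d+1) is onto with kernel
   isomorphic to V_(d-1), for every q; hence t_d := tr (prod_i rho_d(A_i))
   satisfies t_2 t_d = t_(d+1) + t_(d-1), that is, S_n(Trace) = t_(n+1) and
   T_(n+1)(Trace) = t_(n+2) - t_n.  Expanding the trace of the product makes
   t_(n+1) positive.  For the difference, the Pascal rule shows that, after the
   diagonal change of basis diag(q^i), the matrix rho_d(A_i) is dominated
   entrywise by the central d x d block of rho_(d+2)(A_i). *)

Require Import Defs.
From HB Require Import structures.
From mathcomp Require Import all_boot all_order all_algebra.
From mathcomp Require Import reals complex.
From mathcomp Require Import ring zify.

Set Implicit Arguments.
Unset Strict Implicit.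
Unset Printing Implicit Defensive.

Import Order.TTheory GRing.Theory Num.Theory.

Local Open Scope ring_scope.

(** * Gaussian binomials at parameter [p], through their Pascal rule *)

Fixpoint gauss_binom (F : nzRingType) (p : F) (m r : nat) : F :=
  match m, r with
  | _, 0 => 1
  | 0, _.+1 => 0
  | m'.+1, r'.+1 => gauss_binom p m' r' + p ^+ r * gauss_binom p m' r
  end.

Lemma gauss_binomS (F : nzRingType) (p : F) m r :
  gauss_binom p m.+1 r.+1 =
  gauss_binom p m r + p ^+ r.+1 * gauss_binom p m r.+1.
Proof. by []. Qed.

Lemma gauss_binom0 (F : nzRingType) (p : F) m : gauss_binom p m 0 = 1.
Proof. by case: m. Qed.

Lemma gauss_binom_small (F : nzRingType) (p : F) m r :
  (m < r)%N -> gauss_binom p m r = 0.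
Proof.
elim: m r => [|m IHm] [|r] //; rewrite ltnS => lt_mr.
by rewrite gauss_binomS !IHm ?mulr0 ?addr0 // ltnW.
Qed.

(** * Words in [a], [b], [a^-1], and symmetric powers of one quantum triangular matrix *)

Section QuantumTriangular.

Variables (F : fieldType) (A : unitAlgType F) (q : F) (a b : A).
Hypotheses (a_unit : a \is a GRing.unit) (ba : b * a = q *: (a * b)).

(** Powers of [a] and of [a^-1] stay on opposite sides of [b ^+ m]: in this order the entries of the
    symmetric powers carry a bare Gaussian binomial, with no stray power of [q]. *)
Definition word (c : F) (x m y : nat) : A :=
  c *: (a ^+ x * b ^+ m * a^-1 ^+ y).

Lemma word0 x m y : word 0 x m y = 0.
Proof. exact: scale0r. Qed.

Lemma wordZ e c x m y : e *: word c x m y = word (e * c) x m y.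
Proof. exact: scalerA. Qed.

Lemma wordD c c' x m y : word c x m y + word c' x m y = word (c + c') x m y.
Proof. by rewrite /word scalerDl. Qed.

Lemma wordB c c' x m y : word c x m y - word c' x m y = word (c - c') x m y.
Proof. by rewrite /word scalerBl. Qed.

Lemma bXa m : b ^+ m * a = q ^+ m *: (a * b ^+ m).
Proof.
elim: m => [|m IHm]; first by rewrite !expr0 scale1r mul1r mulr1.
rewrite exprS -mulrA IHm -scalerAr (mulrA b a) ba -scalerAl scalerA -exprSr.
by rewrite -mulrA.
Qed.

Lemma baX m : b * a ^+ m = q ^+ m *: (a ^+ m * b).
Proof.
elim: m => [|m IHm]; first by rewrite !expr0 scale1r mul1r mulr1.
rewrite exprSr mulrA IHm -scalerAl -(mulrA _ b) ba -scalerAr scalerA -exprSr.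
by rewrite ?exprSr !mulrA.
Qed.

Lemma aVbX m : a^-1 * b ^+ m = q ^+ m *: (b ^+ m * a^-1).
Proof.
apply: (mulIr a_unit); rewrite -mulrA bXa -scalerAr mulKr //.
by rewrite -scalerAl mulrVK.
Qed.

Lemma mul_a_word c x m y : a * word c x m y = word c x.+1 m y.
Proof. by rewrite /word -scalerAr !mulrA -exprS. Qed.

Lemma mul_b_word c x m y : b * word c x m y = word (c * q ^+ x) x m.+1 y.
Proof.
by rewrite /word -scalerAr !mulrA baX -!scalerAl scalerA -(mulrA _ b) -exprS.
Qed.

Lemma mul_aV_word c x m y : a^-1 * word c x m y = word (c * q ^+ m) x m y.+1.
Proof.
rewrite /word -scalerAr !mulrA.
have -> : a^-1 * a ^+ x = a ^+ x * a^-1.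
  by apply/commrX/commr_sym/commrV.
by rewrite -(mulrA _ a^-1) aVbX -scalerAr -!scalerAl scalerA exprS !mulrA.
Qed.

(** Since [b ^+ m = q ^+ m *: (a * b ^+ m * a^-1)], a word has several spellings; respelling makes
    words from different degrees comparable. *)
Lemma word_split c x m y : word c x m y = word (c * q ^+ m) x.+1 m y.+1.
Proof. by rewrite -mul_a_word -mul_aV_word mulVKr. Qed.

Lemma comm_word z c x m y :
  GRing.comm z a -> GRing.comm z b -> GRing.comm z (word c x m y).
Proof.
move=> za zb; have /(commrX y) zaV := commrV za.
have := commrM (commrM (commrX x za) (commrX m zb)) zaV.
by rewrite /GRing.comm /word -scalerAr -scalerAl => ->.
Qed.

Let gb := gauss_binom (q ^+ 2).

Let gbS m r : gb m.+1 r.+1 = gb m r + q ^+ r.+1 * q ^+ r.+1 * gb m r.+1.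
Proof. by rewrite /gb gauss_binomS -exprMn expr2. Qed.

(* Action of the triangular matrix on the monomials x^i y^(d-1-i) of degree
   d-1 in the quantum plane yx = qxy; [up] selects
   (x, y) |-> (a x + b y, a^-1 y), its negation (a x, b x + a^-1 y). *)
Definition sym_coef (up : bool) (d i l : nat) : A :=
  if up then word (gb i l) l (i - l) (d - i.+1)
  else if (i <= l)%N then word (gb (d - i.+1) (l - i)) i (l - i) (d - l.+1)
  else 0.

Definition tri (up : bool) : 'M[A]_2 :=
  if up then mx22 a b 0 a^-1 else mx22 a 0 b a^-1.

Lemma sym_coef_out up d i l :
  (i < d)%N -> (d <= l)%N -> sym_coef up d i l = 0.
Proof.
move=> lt_id le_dl; rewrite /sym_coef.
have lt_il := leq_trans lt_id le_dl.
case: up; first by rewrite /gb gauss_binom_small ?word0.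
by rewrite (ltnW lt_il) /gb gauss_binom_small ?word0 //; lia.
Qed.

Lemma comm_sym_coef z up d i l :
  GRing.comm z a -> GRing.comm z b -> GRing.comm z (sym_coef up d i l).
Proof.
move=> za zb; rewrite /sym_coef; case: up; first exact: comm_word.
by case: ifP => _; [apply: comm_word | apply: commr0].
Qed.

Lemma tri_entries up :
  [/\ tri up 0 0 = a, tri up 0 1 = if up then b else 0,
      tri up 1 0 = if up then 0 else b & tri up 1 1 = a^-1].
Proof. by case: up; split; rewrite mxE. Qed.

(** Both sides are the coefficient of [x^l y^(d+1-l)] in the image of [x x^i y^(d-i)]; [q ^+ l]
    comes from moving [y] past [x^l]. The upper case is the Pascal rule. *)
Lemma tri_sym_coef_x up d i l : (i < d.+1)%N ->
  (if l is l'.+1 then tri up 0 0 * sym_coef up d.+1 i l' else 0)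
    + q ^+ l *: (tri up 0 1 * sym_coef up d.+1 i l)
  = sym_coef up d.+2 i.+1 l.
Proof.
have [-> -> _ _] := tri_entries up.
case: up => lt_id; rewrite /sym_coef subSS.
  rewrite mul_b_word wordZ; case: l => [|l].
    by rewrite add0r /gb !gauss_binom0 !subn0 !expr0 !mulr1.
  rewrite subSS mul_a_word [in RHS]gbS.
  case: (leqP l.+1 i) => [lt_li|le_il].
    have -> : (i - l = (i - l.+1).+1)%N by lia.
    by rewrite wordD; congr word; ring.
  have -> : gb i l.+1 = 0 by rewrite /gb gauss_binom_small.
  by rewrite !(mulr0, mul0r, addr0, word0).
rewrite mul0r scaler0 addr0; case: l => [|l] //; rewrite ltnS.
by case: ifP => _; rewrite ?mulr0 // mul_a_word !subSS.
Qed.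

(** The same comparison for [y x^i y^(d-i) = q^i x^i y^(d+1-i)]; here the lower case uses the Pascal
    rule. *)
Lemma tri_sym_coef_y up d i l : (i < d.+1)%N ->
  (if l is l'.+1 then tri up 1 0 * sym_coef up d.+1 i l' else 0)
    + q ^+ l *: (tri up 1 1 * sym_coef up d.+1 i l)
  = q ^+ i *: sym_coef up d.+2 i l.
Proof.
have [_ _ -> ->] := tri_entries up.
case: up => lt_id; rewrite /sym_coef.
  rewrite (_ : (if l is l'.+1 then _ else _) = 0) ?add0r; last first.
    by case: l => // l; rewrite mul0r.
  rewrite mul_aV_word !wordZ.
  have -> : (d.+2 - i.+1 = (d.+1 - i.+1).+1)%N by lia.
  case: (leqP l i) => [le_li|lt_il].
    by congr word; rewrite mulrC -mulrA -exprD subnK // mulrC.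
  by rewrite /gb gauss_binom_small // !(mul0r, mulr0, word0).
case: (ltngtP l i) => [lt_li|lt_il|->].
- rewrite mulr0 scaler0 addr0 scaler0.
  by case: l lt_li => // l lt_li; rewrite leqNgt (ltnW lt_li) mulr0.
- case: l lt_il => // l; rewrite ltnS => le_il; rewrite le_il.
  (* For [d <= l] the subtraction in the exponent of [a^-1] is truncated; the vanishing of an
     out-of-range binomial then replaces the exponent computation. *)
  case: (ltnP l d) => [lt_ld|le_dl].
    rewrite mul_b_word mul_aV_word !wordZ.
    have -> : (l.+1 - i = (l - i).+1)%N by lia.
    have -> : (d.+2 - i.+1 = (d.+1 - i.+1).+1)%N by lia.
    have -> : (d.+2 - l.+2 = d.+1 - l.+1)%N by lia.
    have -> : (d.+1 - l.+1 = (d.+1 - l.+2).+1)%N by lia.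
    rewrite wordD; congr word; rewrite [in RHS]gbS.
    rewrite [q ^+ l.+1](_ : _ = q ^+ (l - i).+1 * q ^+ i); last first.
      by rewrite -exprD; congr (_ ^+ _); lia.
    by ring.
  have -> : gb (d.+1 - i.+1) (l.+1 - i) = 0.
    by rewrite /gb gauss_binom_small //; lia.
  rewrite word0 mulr0 scaler0 addr0 mul_b_word wordZ.
  have -> : (l.+1 - i = (l - i).+1)%N by lia.
  have -> : (d.+2 - i.+1 = (d.+1 - i.+1).+1)%N by lia.
  rewrite [in RHS]gbS.
  have -> : gb (d.+1 - i.+1) (l - i).+1 = 0.
    by rewrite /gb gauss_binom_small //; lia.
  have -> : (d.+2 - l.+2 = d.+1 - l.+1)%N by lia.
  by congr word; ring.
rewrite (_ : (if i is l'.+1 then _ else _) = 0) ?add0r; last first.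
  by case: (i) => // l1; rewrite ltnn mulr0.
rewrite mul_aV_word !wordZ subnn /gb !gauss_binom0 expr0 !mulr1.
by congr word; lia.
Qed.

(** For [m = x^i y^(d-1-i)], the kernel vector [q x (x) y m - y (x) x m] is [q^(i+1) x (x) x^i
    y^(d-i) - y (x) x^(i+1) y^(d-1-i)]. Its image combines kernel vectors with coefficients
    [sym_coef up d i]: this is the part in [x (x) _], and [tri_sym_coef_ky] the part in
    [y (x) _]. *)
Lemma tri_sym_coef_kx up d i l : (i < d)%N -> (l < d.+1)%N ->
  q ^+ i.+1 *: (tri up 0 0 * sym_coef up d.+1 i l)
    - tri up 1 0 * sym_coef up d.+1 i.+1 l
  = q ^+ l.+1 *: sym_coef up d i l.
Proof.
have [-> _ -> _] := tri_entries up.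
case: up => lt_id lt_ld; rewrite /sym_coef.
  rewrite mul0r subr0 mul_a_word wordZ (word_split _ _ _ (d - _)) !wordZ.
  have -> : (d.+1 - i.+1 = (d - i.+1).+1)%N by lia.
  case: (leqP l i) => [le_li|lt_il].
    congr word; rewrite [q ^+ i.+1](_ : _ = q ^+ l.+1 * q ^+ (i - l)).
      by ring.
    by rewrite -exprD; congr (_ ^+ _); lia.
  by rewrite /gb gauss_binom_small // !(mul0r, mulr0, word0).
case: (ltngtP l i) => [lt_li|lt_il|->].
- by rewrite !mulr0 !scaler0 subr0.
- rewrite mul_a_word mul_b_word wordZ [in RHS]word_split !wordZ.
  have -> : (l - i = (l - i.+1).+1)%N by lia.
  have -> : (d.+1 - i.+1 = (d - i.+1).+1)%N by lia.
  have -> : (d.+1 - i.+2 = d - i.+1)%N by lia.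
  case: (ltnP l d) => [lt_ld'|le_dl].
    have -> : (d.+1 - l.+1 = (d - l.+1).+1)%N by lia.
    rewrite wordB; congr word; rewrite [gb (_.+1) _]gbS.
    rewrite [q ^+ l.+1](_ : _ = q ^+ (l - i.+1).+1 * q ^+ i.+1).
      by ring.
    by rewrite -exprD; congr (_ ^+ _); lia.
  rewrite wordB [gb (_.+1) _]gbS.
  rewrite (_ : gb (d - i.+1) (l - i.+1).+1 = 0) ?mul0r ?mulr0 ?word0.
    by rewrite addr0 mulrC subrr word0.
  by rewrite /gb gauss_binom_small //; lia.
rewrite mulr0 subr0 mul_a_word subnn.
rewrite [in RHS]word_split !wordZ /gb !gauss_binom0 expr0 !mulr1.
by congr word; lia.
Qed.

Lemma tri_sym_coef_ky up d i l : (i < d)%N ->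
  q ^+ i.+1 *: (tri up 0 1 * sym_coef up d.+1 i l)
    - tri up 1 1 * sym_coef up d.+1 i.+1 l
  = - (if l is l'.+1 then sym_coef up d i l' else 0).
Proof.
have [_ -> _ ->] := tri_entries up.
case: up => lt_id; rewrite /sym_coef.
  rewrite mul_b_word mul_aV_word wordZ.
  have -> : (d.+1 - i.+2 = d - i.+1)%N by lia.
  have -> : (d.+1 - i.+1 = (d - i.+1).+1)%N by lia.
  case: l => [|l].
    rewrite !subn0 /gb !gauss_binom0 expr0 mulr1 mul1r oppr0.
    by rewrite mulr1 subrr.
  rewrite subSS (word_split _ l).
  rewrite [gb (_.+1) _]gbS.
  case: (ltnP l i) => [lt_li|le_il].
    have -> : (i - l = (i - l.+1).+1)%N by lia.
    rewrite wordB -(mulN1r (word _ _ _ _)) -scaleN1r -scalerAl mul1r wordZ.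
    congr word; rewrite [q ^+ i.+1](_ : _ = q ^+ (i - l.+1).+1 * q ^+ l.+1).
      by ring.
    by rewrite -exprD; congr (_ ^+ _); lia.
  have -> : gb i l.+1 = 0 by rewrite /gb gauss_binom_small.
  by rewrite !(mul0r, mulr0, word0, addr0) add0r.
rewrite mul0r scaler0 sub0r; congr (- _).
case: l => [|l]; first by rewrite mulr0.
rewrite ltnS; case: ifP => [le_il|]; last by rewrite mulr0.
rewrite mul_aV_word (word_split _ i) !subSS.
by congr word; lia.
Qed.

(** * Positivity of the entries, and domination of size [d] by size [d + 2] *)

Hypothesis q_neq0 : q != 0.

Definition q_positive (c : F) := exists s : seq int, c = \sum_(n <- s) q ^ n.

Lemma q_positiveX n : q_positive (q ^ n).
Proof. by exists [:: n]; rewrite big_seq1. Qed.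

Lemma q_positiveD c c' : q_positive c -> q_positive c' -> q_positive (c + c').
Proof. by move=> [s ->] [s' ->]; exists (s ++ s'); rewrite big_cat. Qed.

Lemma q_positiveM n c : q_positive c -> q_positive (q ^ n * c).
Proof.
move=> [s ->]; exists [seq n + m | m <- s].
by rewrite big_map mulr_sumr; apply: eq_bigr => m _; rewrite expfzDr.
Qed.

Lemma q_positive0 : q_positive 0.
Proof. by exists [::]; rewrite big_nil. Qed.

Lemma gauss_binom_positive m r : q_positive (gb m r).
Proof.
elim: m r => [|m IHm] [|r]; rewrite ?/gb ?gauss_binom0.
- exact: (q_positiveX 0).
- exact: q_positive0.
- exact: (q_positiveX 0).
rewrite -/gb gbS -mulrA; apply: q_positiveD => //.
by do 2!apply: (q_positiveM (r.+1 : int)).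
Qed.

Definition positive_word (z : A) :=
  exists c x m y, q_positive c /\ z = word c x m y.

Lemma positive_word0 : positive_word 0.
Proof.
by exists 0, 0, 0, 0; split; [exact: q_positive0 | rewrite word0].
Qed.

Lemma positive_wordZ n z : positive_word z -> positive_word (q ^ n *: z).
Proof.
move=> [c [x [m [y [c_pos ->]]]]]; exists (q ^ n * c), x, m, y.
by split; [exact: q_positiveM | rewrite wordZ].
Qed.

Lemma sym_coef_positive up d i l : positive_word (sym_coef up d i l).
Proof.
rewrite /sym_coef; case: up.
  by do 4!eexists; split=> //; apply: gauss_binom_positive.
case: ifP => _; last exact: positive_word0.
by do 4!eexists; split=> //; apply: gauss_binom_positive.
Qed.

(** Once both words are spelled alike, the Pascal rule leaves one term. In the upper case the twist
    cancels the factor from [word_split]; in the lower case the two multiply to [q^(2(l-i))], the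
    weight of the Pascal term to be removed. *)
Lemma sym_coef_sub_positive up d i l : (i < d)%N -> (l < d)%N ->
  positive_word (sym_coef up d.+2 i.+1 l.+1
                   - q ^ (l%:Z - i%:Z) *: sym_coef up d i l).
Proof.
move=> lt_id lt_ld; rewrite /sym_coef; case: up.
  case: (leqP l i) => [le_li|lt_il]; last first.
    rewrite /gb !gauss_binom_small // !word0 scaler0 subr0.
    exact: positive_word0.
  rewrite subSS (word_split _ l) wordZ.
  have -> : (d.+2 - i.+2 = (d - i.+1).+1)%N by lia.
  rewrite wordB gbS; exists (q ^ l.+1 * (q ^ l.+1 * gb i l.+1)).
  exists l.+1, (i - l)%N, (d - i.+1).+1; split.
    by do 2!apply: q_positiveM; apply: gauss_binom_positive.
  congr word; have -> : q ^ (l%:Z - i%:Z) * (gb i l * q ^+ (i - l)) = gb i l.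
    rewrite mulrCA exprnP -expfzDr // (_ : _ + _ = 0) ?expr0z ?mulr1 //; lia.
  by rewrite /exprz; ring.
rewrite ltnS; case: ifP => [le_il|_]; last first.
  by rewrite scaler0 subr0; apply: positive_word0.
rewrite (word_split _ i) wordZ !subSS.
have -> : (d - l = (d - l.+1).+1)%N by lia.
have -> : (d - i = (d - i.+1).+1)%N by lia.
have -> : l%:Z - i%:Z = (l - i)%N by lia.
rewrite wordB; case: (l - i)%N => [|r].
  rewrite /gb !gauss_binom0 expr0z expr0 !mulr1 subrr word0.
  exact: positive_word0.
rewrite gbS; exists (gb (d - i.+1) r), i.+1, r.+1, (d - l.+1).+1.
split; first exact: gauss_binom_positive.
by congr word; rewrite /exprz; ring.
Qed.

(** Each [a^-1] moved leftwards through [b ^+ m] costs [q ^ (- m)]; the result has the shape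
    required of monomials. *)
Lemma word_std c x m y :
  word c x m y = (q ^ (- (m * y)%:Z) * c) *: (a ^ (x%:Z - y%:Z) * b ^+ m).
Proof.
suff baV : b ^+ m * a^-1 ^+ y = q ^ (- (m * y)%:Z) *: (a^-1 ^+ y * b ^+ m).
  rewrite /word -mulrA baV -scalerAr scalerA [c * _]mulrC mulrA.
  congr (_ *: (_ * _)); rewrite exprzDr //; congr (_ * _).
  by rewrite -exprz_inv.
elim: y => [|y IHy]; first by rewrite muln0 !expr0 mulr1 mul1r scale1r.
rewrite [in LHS]exprSr [in LHS]mulrA IHy -scalerAl -(mulrA _ (b ^+ m)).
have -> : b ^+ m * a^-1 = q ^ (- m%:Z) *: (a^-1 * b ^+ m).
  by rewrite aVbX scalerA (exprnP q) -expfzDr // addNr scale1r.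
rewrite -scalerAr scalerA -expfzDr // mulrA -exprSr.
by congr (q ^ _ *: _); lia.
Qed.

End QuantumTriangular.

(** * Scalar intertwiners and additivity of the trace *)

Section Intertwiners.

Variables (F : fieldType) (A : unitAlgType F) (q : F).

(** Left multiplication by [x] on the basis [x^i y^(e-1-i)], images being rows. [twist_mx] is left
    multiplication by [y], with [q ^+ i] from [y x^i = q^i x^i y]. *)
Definition shift_mx e : 'M[A]_(e, e.+1) := \matrix_(i, j) (i.+1 == j)%:R.

Definition twist_mx e : 'M[A]_(e, e.+1) :=
  \matrix_(i, j) (q ^+ i *: ((i : nat) == j)%:R).

(** [g] extends a row to all natural indices, so that shifted entries are named without ordinal
    casts; the next three lemmas follow the same convention. *)
Lemma mulmx_shift m e (B : 'M[A]_(m, e)) (g : nat -> A) u (l : 'I_e.+1) :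
  (forall v : 'I_e, B u v = g v) ->
  (B *m shift_mx e) u l = if (l : nat) is l'.+1 then g l' else 0.
Proof.
move=> Bg; rewrite mxE.
under eq_bigr => v _ do rewrite Bg mxE mulr_natr mulrb.
case: l => -[|l] /= lt_le; first by rewrite big1.
under eq_bigr => v _ do rewrite eqSS.
by rewrite -big_mkcond /= (big_ord1_eq _ g) -ltnS lt_le.
Qed.

Lemma mulmx_twist m e (B : 'M[A]_(m, e)) (g : nat -> A) u (l : 'I_e.+1) :
  (forall v : 'I_e, B u v = g v) ->
  (B *m twist_mx e) u l = if (l < e)%N then q ^+ l *: g l else 0.
Proof.
move=> Bg; rewrite mxE.
under eq_bigr => v _ do rewrite Bg mxE -scalerAr mulr_natr mulrb fun_if scaler0.
by rewrite -big_mkcond /= (big_ord1_eq _ (fun v => q ^+ v *: g v)).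
Qed.

Lemma shift_mulmx m e (C : 'M[A]_(e.+1, m)) (g : nat -> A) (u : 'I_e) l :
  (forall v : 'I_e.+1, C v l = g v) -> (shift_mx e *m C) u l = g u.+1.
Proof.
move=> Cg; rewrite mxE.
under eq_bigr => v _ do rewrite Cg mxE mulr_natl mulrb eq_sym.
by rewrite -big_mkcond /= (big_ord1_eq _ g) ltnS ltn_ord.
Qed.

Lemma twist_mulmx m e (C : 'M[A]_(e.+1, m)) (g : nat -> A) (u : 'I_e) l :
  (forall v : 'I_e.+1, C v l = g v) -> (twist_mx e *m C) u l = q ^+ u *: g u.
Proof.
move=> Cg; rewrite mxE.
under eq_bigr => v _ do
  rewrite Cg mxE -scalerAl mulr_natl mulrb eq_sym fun_if scaler0.
rewrite -big_mkcond /= (big_ord1_eq _ (fun v => q ^+ u *: g v)).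
by rewrite ltnS ltnW.
Qed.

Lemma mulmx_comm_scale m n p (z : A) (X : 'M[A]_(m, n)) (Y : 'M[A]_(n, p)) :
  (forall i j, GRing.comm z (X i j)) -> X *m (z *: Y) = z *: (X *m Y).
Proof.
move=> zX; apply/matrixP => i j; rewrite !mxE mulr_sumr.
by apply: eq_bigr => k _; rewrite mxE !mulrA zX.
Qed.

Definition tens_mx d (w : 'M[A]_2) (X : 'M[A]_d) : 'M[A]_(d + d) :=
  block_mx (w 0 0 *: X) (w 0 1 *: X) (w 1 0 *: X) (w 1 1 *: X).

Lemma tens_mx1 d : tens_mx 1 (1 : 'M[A]_d) = 1%:M.
Proof.
by rewrite /tens_mx !mxE /= scale1r scale0r -scalar_mx_block.
Qed.

(** In the block products an entry of [v] has to cross [X], hence the hypothesis. *)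
Lemma tens_mxM d (w v : 'M[A]_2) (X Y : 'M[A]_d) :
  (forall s t i j, GRing.comm (v s t) (X i j)) ->
  tens_mx (w * v) (X *m Y) = tens_mx w X *m tens_mx v Y.
Proof.
move=> vX; rewrite /tens_mx mulmx_block.
have vXY s t := mulmx_comm_scale Y (vX s t).
have sum2 (f : 'I_2 -> A) : \sum_i f i = f 0 + f 1.
  by rewrite !big_ord_recl big_ord0 addr0; congr (_ + f _); apply/val_inj.
by congr block_mx; rewrite mxE sum2 scalerDl -!scalerA -!vXY -!scalemxAl.
Qed.

(* The multiplication map V_2 (x) V_(d+1) -> V_(d+2) in the quantum plane
   yx = qxy, where V_(d+1) has the basis x^i y^(d-i). *)
Definition mult_mx d : 'M[A]_(d.+1 + d.+1, d.+2) :=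
  col_mx (shift_mx d.+1) (twist_mx d.+1).

(* The kernel of that map, spanned by the q x (x) y m - y (x) x m. *)
Definition ker_mx d : 'M[A]_(d, d.+1 + d.+1) :=
  row_mx (q%:A *: twist_mx d) (- shift_mx d).

(** [Z] and [Y] are the actions on the image and the kernel of the multiplication. No splitting is
    chosen: selected entries of the two relations express the diagonals, and the terms
    [q ^+ i.+1 *: (w 0 1 * x i i.+1)] cancel in the sum. *)
Lemma mxtrace_tens d (w : 'M[A]_2) (X : 'M[A]_d.+1) (Z : 'M[A]_d.+2)
    (Y : 'M[A]_d) :
  tens_mx w X *m mult_mx d = mult_mx d *m Z ->
  ker_mx d *m tens_mx w X = Y *m ker_mx d ->
  \tr w * \tr X = \tr Z + \tr Y.
Proof.
rewrite /mult_mx mul_block_col mul_col_mx => /eq_col_mx[WQx WQy].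
rewrite /ker_mx mul_row_block mul_mx_row => /eq_row_mx[_ KWy].
pose x i l := X (inord i) (inord l); pose z i := Z (inord i) (inord i).
(* At [i = d] the neighbour [x i i.+1] would lie outside [X]; the guard puts 0 there. *)
have diag_x (i : 'I_d.+1) :
    w 0 0 * x i i
      + (if (i < d)%N then q ^+ i.+1 *: (w 0 1 * x i i.+1) else 0) = z i.+1.
  have := congr1 (fun C : 'M_(_, _) => C i (lift ord0 i)) WQx.
  rewrite mxE (mulmx_shift (g := fun l => w 0 0 * x i l)); last first.
    by move=> v; rewrite mxE /x !inord_val.
  rewrite (mulmx_twist (g := fun l => w 0 1 * x i l)); last first.
    by move=> v; rewrite mxE /x !inord_val.
  rewrite (shift_mulmx (g := fun k => Z (inord k) (lift ord0 i))); last first.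
    by move=> v; rewrite inord_val.
  rewrite lift0 ltnS => ->; rewrite /z; congr (Z _ _).
  by apply/val_inj; rewrite /= inordK // ltnS.
have diag_y0 : w 1 1 * x 0 0 = z 0.
  have := congr1 (fun C : 'M_(_, _) => C 0 0) WQy.
  rewrite mxE (mulmx_shift (g := fun l => w 1 0 * x 0 l)); last first.
    by move=> v; rewrite mxE /x -[X in inord X]/(val (0 : 'I_d.+1)) !inord_val.
  rewrite (mulmx_twist (g := fun l => w 1 1 * x 0 l)); last first.
    by move=> v; rewrite mxE /x -[X in inord X]/(val (0 : 'I_d.+1)) !inord_val.
  rewrite (twist_mulmx (g := fun k => Z (inord k) 0)); last first.
    by move=> v; rewrite inord_val.
  rewrite add0r !expr0 !scale1r => ->; rewrite /z; congr (Z _ _).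
  by apply/val_inj; rewrite /= inordK.
have diag_y (i : 'I_d) :
    w 1 1 * x i.+1 i.+1 = q ^+ i.+1 *: (w 0 1 * x i i.+1) + Y i i.
  have := congr1 (fun C : 'M_(_, _) => C i (lift ord0 i)) KWy.
  rewrite mxE -scalemxAl mulNmx mulmxN 2![fun_of_matrix (- _) _ _]mxE.
  rewrite [fun_of_matrix (_ *: (_ *m _)) _ _]mxE mulr_algl.
  rewrite (twist_mulmx (g := fun k => w 0 1 * x k i.+1)); last first.
    move=> v; rewrite mxE /x inord_val; congr (_ * X _ _).
    by apply/val_inj; rewrite /= inordK // ltnS.
  rewrite (shift_mulmx (g := fun k => w 1 1 * x k i.+1)); last first.
    move=> v; rewrite mxE /x inord_val; congr (_ * X _ _).
    by apply/val_inj; rewrite /= inordK // ltnS.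
  (* ['I_d] may be empty, so the row of [Y] is extended by [insub] with default 0 rather than by
     [inord]. *)
  rewrite (mulmx_shift (g := fun l => oapp (Y i) 0 (insub l))); last first.
    by move=> v; rewrite valK.
  rewrite lift0 valK /= scalerA -exprS => /eqP.
  by rewrite subr_eq => /eqP ->; rewrite addrC addNKr.
have trX : \tr X = \sum_(i < d.+1) x i i.
  by apply: eq_bigr => i _; rewrite /x inord_val.
have trZ : \tr Z = \sum_(i < d.+2) z i.
  by apply: eq_bigr => i _; rewrite /z inord_val.
have -> : \tr w = w 0 0 + w 1 1.
  rewrite /mxtrace !big_ord_recl big_ord0 addr0; congr (_ + w _ _);
  exact/val_inj.
rewrite trX trZ mulrDl [\sum_(i < d.+2) _]big_ord_recl -diag_y0.
under [X in _ = _ + X + _]eq_bigr => i _ do rewrite lift0 -diag_x.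
rewrite big_split /= -mulr_sumr -!addrA [RHS]addrCA; congr (_ + _).
rewrite [X in _ = _ + (X + _)]big_ord_recr /= ltnn addr0.
under [X in _ = _ + (X + _)]eq_bigr => i _ do rewrite ltn_ord.
rewrite big_ord_recl mulrDr; congr (_ + _).
by rewrite mulr_sumr -big_split; apply: eq_bigr => i _; exact: diag_y.
Qed.

(** * Symmetric powers of a triangular matrix respect the intertwiners *)

Variables (a b : A).
Hypotheses (a_unit : a \is a GRing.unit) (ba : b * a = q *: (a * b)).

Definition sym_mx (up : bool) (d : nat) : 'M[A]_d :=
  \matrix_(i, l) sym_coef q a b up d i l.

Local Notation sc := (sym_coef q a b).
Local Notation w := (tri a b).

Lemma tens_sym_mult_mx up d :
  tens_mx (w up) (sym_mx up d.+1) *m mult_mx d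
  = mult_mx d *m sym_mx up d.+2.
Proof.
rewrite /mult_mx mul_block_col mul_col_mx.
have tailE (s : 'I_2) (i : 'I_d.+1) (l : 'I_d.+2) :
    (if (l < d.+1)%N then q ^+ l *: (w up s 1 * sc up d.+1 i l) else 0)
    = q ^+ l *: (w up s 1 * sc up d.+1 i l).
  by case: ltnP => // le_dl; rewrite sym_coef_out // mulr0 scaler0.
congr col_mx; apply/matrixP => i l; rewrite mxE.
  rewrite (mulmx_shift (g := fun l => w up 0 0 * sc up d.+1 i l));
    last by move=> v; rewrite !mxE.
  rewrite (mulmx_twist (g := fun l => w up 0 1 * sc up d.+1 i l));
    last by move=> v; rewrite !mxE.
  rewrite tailE tri_sym_coef_x //.
  rewrite (shift_mulmx (g := fun i => sc up d.+2 i l)) // => v.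
  by rewrite mxE.
rewrite (mulmx_shift (g := fun l => w up 1 0 * sc up d.+1 i l));
  last by move=> v; rewrite !mxE.
rewrite (mulmx_twist (g := fun l => w up 1 1 * sc up d.+1 i l));
  last by move=> v; rewrite !mxE.
rewrite tailE tri_sym_coef_y //.
rewrite (twist_mulmx (g := fun i => sc up d.+2 i l)) // => v.
by rewrite mxE.
Qed.

Lemma ker_mx_tens_sym up d :
  ker_mx d *m tens_mx (w up) (sym_mx up d.+1)
  = sym_mx up d *m ker_mx d.
Proof.
rewrite /ker_mx mul_row_block mul_mx_row.
congr row_mx; apply/matrixP => i l; rewrite mxE mulNmx -scalemxAl.
  rewrite (mulmx_comm_scale (z := q%:A)); last by move=> *; apply: comm_alg.
  rewrite 2![fun_of_matrix (_ *: (_ *m _)) _ _]mxE [fun_of_matrix (- _) _ _]mxE.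
  rewrite !mulr_algl.
  rewrite (twist_mulmx (g := fun i => w up 0 0 * sc up d.+1 i l));
    last by move=> v; rewrite !mxE.
  rewrite (shift_mulmx (g := fun i => w up 1 0 * sc up d.+1 i l));
    last by move=> v; rewrite !mxE.
  rewrite (mulmx_twist (g := fun l => sc up d i l));
    last by move=> v; rewrite !mxE.
  rewrite scalerA -exprS tri_sym_coef_kx //; case: ltnP => le_dl.
    by rewrite scalerA -exprS.
  by rewrite sym_coef_out // !scaler0.
rewrite mulmxN 2![fun_of_matrix (- _) _ _]mxE.
rewrite [fun_of_matrix (_ *: (_ *m _)) _ _]mxE mulr_algl.
rewrite (twist_mulmx (g := fun i => w up 0 1 * sc up d.+1 i l));
  last by move=> v; rewrite !mxE.
rewrite (shift_mulmx (g := fun i => w up 1 1 * sc up d.+1 i l));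
  last by move=> v; rewrite !mxE.
rewrite (mulmx_shift (g := fun l => sc up d i l));
  last by move=> v; rewrite !mxE.
by rewrite scalerA -exprS tri_sym_coef_ky.
Qed.

End Intertwiners.

Lemma eval_int_mulX_sub (A : nzRingType) (p p' : {poly int}) (x : A) :
  eval_int ('X * p - p') x = x * eval_int p x - eval_int p' x.
Proof.
rewrite /eval_int rmorphB rmorphM /= map_polyX hornerD hornerN.
rewrite hornerM_comm ?hornerX //; apply: comm_coef_poly => i.
by rewrite coef_map; apply/commr_sym/commr_int.
Qed.

(** * Products over a commuting family, indexed by duplicate-free lists *)

Section CommutingFamily.

Variables (F : fieldType) (A : unitAlgType F) (q : F) (I : eqType).
Variables (a b : I -> A) (up : I -> bool).
Hypotheses (q_neq0 : q != 0) (a_unit : forall i, a i \is a GRing.unit).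
Hypothesis ba : forall i, b i * a i = q *: (a i * b i).
Hypothesis ab_comm : forall i j, i != j ->
  [/\ GRing.comm (a i) (a j), GRing.comm (a i) (b j),
      GRing.comm (b i) (a j) & GRing.comm (b i) (b j)].

(** The list [r] allows induction on the number of factors; the theorem takes for [r] the
    enumeration of ['I_k]. *)
Definition positive (r : seq I) (x : A) :=
  exists s : seq (int * (I -> int) * (I -> nat)),
    x = \sum_(m <- s)
          q ^ m.1.1 *: \prod_(i <- r) (a i ^ m.1.2 i * b i ^+ m.2 i).

Lemma positive0 r : positive r 0.
Proof. by exists [::]; rewrite big_nil. Qed.

Lemma positiveD r x y : positive r x -> positive r y -> positive r (x + y).
Proof. by move=> [s ->] [s' ->]; exists (s ++ s'); rewrite big_cat. Qed.

Lemma positive_sum r (J : Type) (s : seq J) (f : J -> A) :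
  (forall j, positive r (f j)) -> positive r (\sum_(j <- s) f j).
Proof.
move=> f_pos; apply: (big_ind (positive r)) => //; first exact: positive0.
exact: positiveD.
Qed.

Lemma positive_nil : positive [::] 1.
Proof.
exists [:: (0, fun=> 0, fun=> 0%N)].
by rewrite big_seq1 big_nil expr0z scale1r.
Qed.

(** As [i] is not in [r], the exponents at [i] can be overridden by those of [z] in the form given
    by [word_std]. *)
Lemma positive_cons i r z x : i \notin r ->
  positive_word q (a i) (b i) z -> positive r x -> positive (i :: r) (z * x).
Proof.
move=> r'i [c [n [m [y [[s ->] ->]]]]] [t ->].
rewrite (word_std (a_unit i) (ba i) q_neq0) mulr_sumr scaler_suml mulr_suml.
apply: positive_sum => e; rewrite mulr_sumr; apply: positive_sum => p.
exists [:: (- (m * y)%:Z + e + p.1.1,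
            fun j => if j == i then n%:Z - y%:Z else p.1.2 j,
            fun j => if j == i then m else p.2 j)].
rewrite big_seq1 big_cons /= eqxx -scalerAl -scalerAr scalerA !expfzDr //.
congr (_ *: (_ * _)); apply: eq_big_seq => j rj.
by rewrite (negPf (memPn r'i j rj)).
Qed.

Definition sym_prod (d : nat) (r : seq I) : 'M[A]_d :=
  \prod_(i <- r) sym_mx q (a i) (b i) (up i) d.

Lemma sym_prod_cons d i r :
  sym_prod d (i :: r) = sym_mx q (a i) (b i) (up i) d *m sym_prod d r.
Proof. by rewrite /sym_prod big_cons. Qed.

Lemma sym_prod_nil d : sym_prod d [::] = 1%:M.
Proof. by rewrite /sym_prod big_nil. Qed.

Lemma positive_sym_prod d r u v : uniq r -> positive r (sym_prod d r u v).
Proof.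
elim: r u => [|i r IHr] u /=.
  rewrite sym_prod_nil mxE; case: (u == v) => _; last exact: positive0.
  exact: positive_nil.
case/andP=> r'i Ur; rewrite sym_prod_cons mxE; apply: positive_sum => w.
rewrite mxE; apply: positive_cons => //; last exact: IHr.
exact: sym_coef_positive.
Qed.

Let emb d (u : 'I_d) : 'I_d.+2 := lift ord0 (widen_ord (leqnSn d) u).

(** [emb] selects the central block. Off-diagonal entries are included because the induction on the
    product meets them; the twists compose along products and disappear when [u = v]. *)
Lemma positive_sym_prod_sub d r (u v : 'I_d) : uniq r ->
  positive r (sym_prod d.+2 r (emb u) (emb v)
                - q ^ (v%:Z - u%:Z) *: sym_prod d r u v).
Proof.
elim: r u => [|i r IHr] u /=.
  rewrite !sym_prod_nil !mxE (inj_eq lift_inj) -!val_eqE /= => _.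
  case: eqP => [->|_]; last by rewrite scaler0 subr0; apply: positive0.
  by rewrite subrr expr0z scale1r subrr; apply: positive0.
case/andP=> r'i Ur; rewrite !sym_prod_cons !mxE big_ord_recl big_ord_recr /=.
have z_pos w : positive (i :: r)
    (sym_mx q (a i) (b i) (up i) d.+2 (emb u) w * sym_prod d.+2 r w (emb v)).
  apply: positive_cons => //; last exact: positive_sym_prod.
  by rewrite mxE; apply: sym_coef_positive.
rewrite scaler_sumr [X in _ + X - _]addrC -!addrA -sumrB.
(* The two outer intermediate indices have no counterpart in size [d]; their terms are positive by
   themselves. *)
apply: positiveD; first exact: z_pos.
apply: positiveD; first exact: z_pos.
apply: positive_sum => k; rewrite -/(emb k).
set V := sym_mx _ _ _ _ _ _ _; set V' := sym_mx _ _ _ _ _ _ _.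
set X := sym_prod _ _ _ _; set Y := sym_prod _ _ _ _.
(* A difference of products becomes a sum of two products of positive factors, one difference in
   each. *)
have -> : V * X - q ^ (v%:Z - u%:Z) *: (V' * Y)
    = (V - q ^ (k%:Z - u%:Z) *: V') * X
      + (q ^ (k%:Z - u%:Z) *: V') * (X - q ^ (v%:Z - k%:Z) *: Y).
  rewrite mulrBl mulrBr addrA subrK -scalerAl -scalerAr scalerA -expfzDr //.
  by congr (_ - q ^ _ *: _); lia.
apply: positiveD; apply: positive_cons => //.
- rewrite /V /V' !mxE.
  have := sym_coef_sub_positive (a_unit i) (ba i) q_neq0 (up i).
  by move/(_ d u k (ltn_ord u) (ltn_ord k)).
- exact: positive_sym_prod.
- by apply: positive_wordZ => //; rewrite /V' mxE; apply: sym_coef_positive.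
- exact: IHr.
Qed.

(** * Traces of the symmetric powers and the Chebyshev recurrences *)

Definition tri_prod (r : seq I) : 'M[A]_2 :=
  \prod_(i <- r) tri (a i) (b i) (up i).

Lemma comm_tri_prod r z :
  (forall j, j \in r -> GRing.comm z (a j) /\ GRing.comm z (b j)) ->
  forall s t, GRing.comm z (tri_prod r s t).
Proof.
elim: r => [|j r IHr] z_comm s t.
  rewrite /tri_prod big_nil mxE.
  by case: (s == t); [apply: commr1 | apply: commr0].
rewrite /tri_prod big_cons mxE; apply: commr_sum => k _; apply: commrM.
  have [za zb] := z_comm j (mem_head _ _).
  case: (up j); rewrite mxE; do !case: ifP => _ //;
    by [apply: commr0 | apply: commrV].
by apply: IHr => i ri; apply: z_comm; rewrite inE ri orbT.
Qed.

(** The relations compose factor by factor. Commutation between distinct indices lets the entries of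
    [tri_prod r] cross the symmetric power at [i], as [tens_mxM] demands. *)
Lemma tens_sym_prod d r : uniq r ->
  tens_mx (tri_prod r) (sym_prod d.+1 r) *m mult_mx A q d
    = mult_mx A q d *m sym_prod d.+2 r
  /\ ker_mx A q d *m tens_mx (tri_prod r) (sym_prod d.+1 r)
    = sym_prod d r *m ker_mx A q d.
Proof.
elim: r => [|i r IHr] /=.
  rewrite /tri_prod !sym_prod_nil big_nil tens_mx1.
  by rewrite !mulmx1 !mul1mx.
case/andP=> r'i /IHr[WQ KW]; rewrite /tri_prod big_cons -/(tri_prod r).
rewrite !sym_prod_cons tens_mxM; last first.
  move=> s t u v; apply/commr_sym/comm_tri_prod => j rj.
  have [] := ab_comm (memPn r'i j rj) => aa ab ba' bb.
  by rewrite mxE; split; apply: commr_sym; apply: comm_sym_coef.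
split; first by rewrite -mulmxA WQ !mulmxA tens_sym_mult_mx.
by rewrite mulmxA ker_mx_tens_sym // -!mulmxA KW.
Qed.

Lemma mxtrace_sym_prod_rec d r : uniq r ->
  \tr (tri_prod r) * \tr (sym_prod d.+1 r)
  = \tr (sym_prod d.+2 r) + \tr (sym_prod d r).
Proof. by case/(tens_sym_prod d)=> WQ KW; apply: mxtrace_tens WQ KW. Qed.

Lemma mxtrace_sym_prod0 r : \tr (sym_prod 0 r) = 0.
Proof. by rewrite /mxtrace big_ord0. Qed.

Lemma mxtrace_sym_prod1 r : \tr (sym_prod 1 r) = 1.
Proof.
rewrite /mxtrace big_ord1; elim: r => [|i r IHr].
  by rewrite sym_prod_nil mxE.
rewrite sym_prod_cons mxE big_ord1 {}IHr mxE mulr1 /sym_coef /word.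
by case: (up i); rewrite /= !expr0 !mulr1 scale1r.
Qed.

(** The recurrence at [d = 0] spares an entrywise comparison, in which the two bases come in
    opposite orders. *)
Lemma mxtrace_tri_prod r : uniq r -> \tr (tri_prod r) = \tr (sym_prod 2 r).
Proof.
move/(mxtrace_sym_prod_rec 0).
by rewrite mxtrace_sym_prod1 mxtrace_sym_prod0 mulr1 addr0.
Qed.

Lemma eval_chebS_tri_prod r n : uniq r ->
  eval_int (chebS n) (\tr (tri_prod r)) = \tr (sym_prod n.+1 r).
Proof.
move=> Ur; elim/ltn_ind: n => -[|[|n]] IHn.
- by rewrite /eval_int rmorph1 hornerC mxtrace_sym_prod1.
- by rewrite /eval_int map_polyX hornerX mxtrace_tri_prod.
rewrite [chebS _]/('X * chebS n.+1 - chebS n) eval_int_mulX_sub !IHn //.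
by rewrite mxtrace_sym_prod_rec // addrK.
Qed.

Lemma eval_chebT_tri_prod r n : uniq r ->
  eval_int (chebT n.+1) (\tr (tri_prod r))
  = \tr (sym_prod n.+2 r) - \tr (sym_prod n r).
Proof.
move=> Ur; elim/ltn_ind: n => -[|[|n]] IHn.
- rewrite /eval_int map_polyX hornerX mxtrace_sym_prod0 subr0.
  exact: mxtrace_tri_prod.
(* [T_0 = 2] is outside the formula, so [T_2] is a separate case: [t_3 + t_1 - 2 = t_3 - t_1]
   because [t_1 = 1]. *)
- rewrite [chebT _]/('X * chebT 1 - 2%:R) eval_int_mulX_sub IHn //.
  rewrite mxtrace_sym_prod0 subr0 mxtrace_sym_prod_rec // mxtrace_sym_prod1.
  by rewrite /eval_int rmorph_nat -polyC_natr hornerC mulr2n opprD addrA addrK.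
rewrite [chebT _]/('X * chebT n.+2 - chebT n.+1) eval_int_mulX_sub !IHn //.
by rewrite mulrBr !mxtrace_sym_prod_rec // addrKA opprB addrA subrK.
Qed.

Lemma positive_chebS r n : uniq r ->
  positive r (eval_int (chebS n) (\tr (tri_prod r))).
Proof.
move=> Ur; rewrite eval_chebS_tri_prod //; apply: positive_sum => u.
exact: positive_sym_prod.
Qed.

Lemma positive_chebT r n : uniq r ->
  positive r (eval_int (chebT n) (\tr (tri_prod r))).
Proof.
case: n => [|n] Ur.
  have -> x : eval_int (chebT 0) x
      = eval_int (chebS 0) x + eval_int (chebS 0) x :> A.
    by rewrite /eval_int rmorph_nat rmorph1 hornerC -polyC_natr hornerC.
  by apply: positiveD; apply: positive_chebS.
rewrite eval_chebT_tri_prod // /mxtrace big_ord_recl big_ord_recr /=.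
rewrite [X in _ + X - _]addrC -!addrA -sumrB.
(* The first and last diagonal entries stand alone; the central ones are paired with the smaller
   trace. *)
apply: positiveD; first exact: positive_sym_prod.
apply: positiveD; first exact: positive_sym_prod.
apply: positive_sum => u.
by have := positive_sym_prod_sub u u Ur; rewrite subrr expr0z scale1r.
Qed.

End CommutingFamily.

(** * Conclusion for the given matrices *)

Local Open Scope complex_scope.

Theorem proposition21 (R : realType) (A : unitAlgType R[i]) (q : R[i])
    (hq : q != 0) (k : nat) (M : 'I_k -> 'M[A]_2) (a b : 'I_k -> A)
    (htri : forall i : 'I_k,
       M i = mx22 (a i) (b i) 0 (a i)^-1 \/ M i = mx22 (a i) 0 (b i) (a i)^-1)
    (hunit : forall i : 'I_k, a i \is a GRing.unit)
    (hqcomm : forall i : 'I_k, b i * a i = q *: (a i * b i))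
    (hcomm : forall i j : 'I_k, i != j ->
       [/\ GRing.comm (a i) (a j), GRing.comm (a i) (b j),
           GRing.comm (b i) (a j) & GRing.comm (b i) (b j)])
    (n : nat) :
  sum_of_positive_monomials q a b
    (eval_int (chebS n) (\tr (\prod_(i < k) M i)))
  /\ sum_of_positive_monomials q a b
    (eval_int (chebT n) (\tr (\prod_(i < k) M i))).
Proof.
(* Decidable equality of matrices turns the disjunction [htri] into a boolean; if both forms agree,
   either choice is correct. *)
pose up i := M i == mx22 (a i) (b i) 0 (a i)^-1.
have -> : \prod_(i < k) M i = tri_prod a b up (index_enum 'I_k).
  apply: eq_bigr => i _; rewrite /up /tri.
  by case: eqP => // notM; case: (htri i).
have Uk := index_enum_uniq 'I_k.
by split; [apply: positive_chebS | apply: positive_chebT].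
Qed.
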